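(* Let $H=(V,E)$ be the hexagonal graph, let $$X=\mathbb{Z}^2\backslash\{(p,q)\;|\;p\le 0,\;p-1\le q\le 1-p\}\subset V$$ be the slit plane domain and let $a=(0,0)(1,0)\in\partial X$. Let $\zeta=\exp(2\pi i/6)$ and, for $j\in\{0,1,\dots,7\}$, $y_j=\exp(2\pi i(6j+1)/48)$. For each $l\in\{0,1,\dots,5\}$ and $k\in\{0,1,\dots,47\}$ consider the generating function $$G_{l,k}(x)=\sum_{\ell(w)=\zeta^l,\;r(w)\equiv k\;(\mathrm{mod}\;48)}x^{|w|},$$ where the sum is over the self-avoiding walks $w$ in $H$ that start in $a$ (first vertex $(0,0)$, first edge $a$) and have all vertices but the first in $X$. Then for each $j\in\{0,1,\dots,7\}$ we have in $\mathbb{C}[[x]]$ the formal identity $$\frac{x}{1+2\,\mathrm{Re}(\zeta^4y_j)\,x}=-\sum_{l=0}^{5}\sum_{k=0}^{47}\zeta^l y_j^k\,G_{l,k}(x).$$ Moreover (as follows from the case $j=7$), $G_{l,k}(x_c)=+\infty$ for some $l,k$, where $x_c=\frac{1}{2\cos(\pi/8)}$.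
   Context: **Hexagonal graph.** $H=(V,E)$ is the plane graph with $V=\mathbb{Z}\times\mathbb{Z}\subset\mathbb{R}^2$, whose edges are all vertical unit segments $(p,q)(p,q+1)$ and those horizontal unit segments $(p,q)(p+1,q)$ with $p\equiv q \pmod 2$. It is a cubic graph isomorphic to the hexagonal lattice graph. For $X\subset V$, $\partial X$ is the set of edges with exactly one endvertex in $X$. **Walks.** A walk in $H$ is a sequence $w=(v_1,e_1,v_2,e_2,\dots,e_n,v_{n+1})$ with $n\ge 1$, $e_j=v_jv_{j+1}\in E$ and $e_j\neq e_{j+1}$ (no backtracks); $|w|=n$ is its length. A self-avoiding walk (SAW) is a walk with all $v_j$ distinct. **Directions $\ell$.** An oriented edge is a pair $(e,v)$ with $v$ an endvertex of $e$, thought of as $e$ oriented away from $v$. The basic orientation of an edge is left-to-right (horizontal edges) or bottom-to-top (vertical edges). Let $\ell_b(e)=1$ for horizontal $e$, and for vertical $e$ let $\ell_b(e)=\zeta$ (resp. $\zeta^2$) if the top vertex of $e$ is incident with a horizontal edge going to the right (resp. to the left). Put $\ell(e,v)=\ell_b(e)$ if $(e,v)$ is oriented as in the basic orientation and $\ell(e,v)=-\ell_b(e)$ otherwise. For a walk $w$ with final vertex $v_{n+1}$ and final edge $e_n$, $\ell(w)=\ell(e_n,v_{n+1})$, i.e. the final edge is oriented oppositely to the direction of the walk. **Winding number $r$.** A hook is a SAW $(v_1,e_1,v_2,e_2,v_3)$ of length $2$. It is a left hook, of weight $+1$, if it turns left (i.e. $e_2$ comes immediately clockwise after $e_1$ around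 $v_2$), and a right hook, of weight $-1$, if it turns right ($e_2$ comes immediately counter-clockwise after $e_1$). For a walk $w=(v_1,e_1,\dots,e_n,v_{n+1})$, $r(w)\in\mathbb{Z}$ is the sum of the weights of the hooks $(v_i,e_i,v_{i+1},e_{i+1},v_{i+2})$, $1\le i\le n-1$ (so $r(w)=0$ if $|w|=1$). $G_{l,k}(x_c)=+\infty$ means that the power series $G_{l,k}$, which has nonnegative coefficients, diverges at the positive real number $x_c$. *)

(* Defs.v *)
From HB Require Import structures.
From mathcomp Require Import all_boot all_order all_algebra.
From mathcomp Require Import finmap.
From mathcomp Require Import all_classical all_reals all_analysis.
From mathcomp Require Import complex.

Set Implicit Arguments.
Unset Strict Implicit.
Unset Printing Implicit Defensive.

Import Order.TTheory GRing.Theory Num.Theory.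
Local Open Scope classical_set_scope.
Local Open Scope ring_scope.
Local Open Scope complex_scope.

(* Formal power series over K, as coefficient sequences. *)
Section FormalPowerSeries.
Variable K : fieldType.
Implicit Types f g : nat -> K.

Definition fps_of_poly (p : {poly K}) : nat -> K := fun n => p`_n.

Definition fps_mul f g : nat -> K :=
  fun n => \sum_(i < n.+1) f i * g (n - i)%N.

(* The first n.+1 coefficients of 1 / f, from the recursion
   f_0 g_n = - \sum_(i < n) f_(n-i) g_i. *)
Fixpoint fps_inv_coefs f n : seq K :=
  if n is m.+1 then
    let s := fps_inv_coefs f m in
    rcons s (- (f 0%N)^-1 * \sum_(i < m.+1) f (m.+1 - i)%N * s`_i)
  else [:: (f 0%N)^-1].

(* Meaningful only when f 0 is nonzero; see fps_mulfV. *)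
Definition fps_inv f : nat -> K := fun n => (fps_inv_coefs f n)`_n.

Definition fps_div f g : nat -> K := fps_mul f (fps_inv g).

Lemma size_fps_inv_coefs f n : size (fps_inv_coefs f n) = n.+1.
Proof. by elim: n => //= n IHn; rewrite size_rcons IHn. Qed.

Lemma nth_fps_inv_coefs f n i : (i <= n)%N ->
  (fps_inv_coefs f n)`_i = fps_inv f i.
Proof.
elim: n => [|n IHn] /=; first by rewrite leqn0 => /eqP->.
rewrite leq_eqVlt => /orP[/eqP->//|lt_in].
by rewrite nth_rcons size_fps_inv_coefs lt_in IHn.
Qed.

Lemma fps_invS f n : fps_inv f n.+1 =
  - (f 0%N)^-1 * \sum_(i < n.+1) f (n.+1 - i)%N * fps_inv f i.
Proof.
rewrite /fps_inv /= nth_rcons size_fps_inv_coefs ltnn eqxx.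
congr (_ * _); apply: eq_bigr => i _.
by rewrite nth_fps_inv_coefs // -ltnS.
Qed.

Lemma fps_mulfV f : f 0%N != 0 ->
  fps_mul f (fps_inv f) =1 fps_of_poly (1 : {poly K}).
Proof.
move=> f0 [|n]; rewrite /fps_mul /fps_of_poly coef1.
  by rewrite big_ord_recl big_ord0 addr0 subnn /= divff.
rewrite big_ord_recl /= subn0 fps_invS mulrA mulrN divff // mulN1r.
rewrite [X in - X + _](reindex_inj rev_ord_inj) /=.
apply/eqP; rewrite addrC subr_eq0; apply/eqP; apply: eq_bigr => i _.
by rewrite /bump /= add1n !subSS subSn ?leq_subr // subKn // -ltnS.
Qed.

End FormalPowerSeries.

Definition vertex : Type := (int * int)%type.

(* basic u v: uv is an edge whose basic orientation is from u to v. *)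
Definition basic (u v : vertex) : bool :=
  (v == (u.1, u.2 + 1)) ||
  (v == (u.1 + 1, u.2)) && (u.1 == u.2 %[mod 2])%Z.

Definition adj (u v : vertex) : bool := basic u v || basic v u.

(* The neighbours of v in counterclockwise order, starting from the east. *)
Definition rotation (v : vertex) : seq vertex :=
  [seq u <- [:: (v.1 + 1, v.2); (v.1, v.2 + 1); (v.1 - 1, v.2); (v.1, v.2 - 1)]
   | adj v u].

(* H is simple, so a walk is given by its vertices v_1, ..., v_(n+1), n >= 1;
   consecutive edges are distinct iff v_j != v_(j+2). *)
Definition is_walk (w : seq vertex) : bool :=
  [&& (1 < size w)%N, sorted adj w &
      all (fun t => t.1 != t.2) (zip w (drop 2 w))].

Definition is_saw (w : seq vertex) : bool := is_walk w && uniq w.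

Definition walk_length (w : seq vertex) : nat := (size w).-1.

(* The weight of the hook through x, v, y: the edge vy comes right after the
   edge vx around v, clockwise for a left hook (prev, since rotation v is
   counterclockwise), and otherwise, v being of degree 3, counterclockwise. *)
Definition hook_weight (x v y : vertex) : int :=
  if y == prev (rotation v) x then 1 else -1.

Definition winding (w : seq vertex) : int :=
  \sum_(i < size w - 2)
    hook_weight (nth (0, 0) w i) (nth (0, 0) w i.+1) (nth (0, 0) w i.+2).

Definition slit_plane (v : vertex) : bool :=
  ~~ ((v.1 <= 0) && (v.1 - 1 <= v.2 <= 1 - v.1)).

(* The SAWs starting with the edge (0,0)(1,0) and staying in the slit plane
   domain after their first vertex. *)
Definition slit_saw (w : seq vertex) : bool :=
  [&& is_saw w, take 2 w == [:: (0, 0); (1, 0)] & all slit_plane (behead w)].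

Section Directions.
Variable R : realType.

Definition expi (t : R) : R[i] := cos t +i* sin t.

Definition zeta : R[i] := expi (2 * pi / 6).

Definition y_ (j : nat) : R[i] := expi (2 * pi * (6 * j + 1)%:R / 48).

Definition x_c : R := (2 * cos (pi / 8))^-1.

(* ell_b of the edge uv, for basic u v. *)
Definition ell_b (u v : vertex) : R[i] :=
  if u.2 == v.2 then 1
  else if adj v (v.1 + 1, v.2) then zeta else zeta ^+ 2.

(* ell (e, u) for the edge e = uv, oriented away from u. *)
Definition ell (u v : vertex) : R[i] :=
  if basic u v then ell_b u v else - ell_b v u.

(* The final edge is oriented away from the final vertex. *)
Definition walk_ell (w : seq vertex) : R[i] :=
  ell (nth (0, 0) w (size w).-1) (nth (0, 0) w (size w).-2).

Definition G_walks (l k n : nat) : set (seq vertex) :=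
  [set w | [/\ slit_saw w, walk_length w = n,
               walk_ell w = zeta ^+ l & (winding w = k%:Z %[mod 48])%Z]].

(* The coefficient of x^n in G_(l,k); the set is finite by finite_G_walks. *)
Definition G_coef (l k n : nat) : nat := #|` fset_set (G_walks l k n)|%fset.

Lemma finite_G_walks l k n : finite_set (G_walks l k n).
Proof.
pose fix paths m v {struct m} : seq (seq vertex) :=
  if m is m'.+1 then
    flatten [seq [seq u :: p | p <- paths m' u] | u <- rotation v]
  else [:: [::]].
have adj_rotation v u : adj v u -> u \in rotation v.
  move=> avu; rewrite mem_filter avu /=; move: avu; rewrite !inE /adj /basic.
  case/orP=> [/orP[->|/andP[->]]|/orP[/eqP->|/andP[/eqP->]]] /=;
    by rewrite ?addrK -?surjective_pairing ?eqxx ?orbT.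
have pathsP m v p : path adj v p -> size p = m -> p \in paths m v.
  elim: m v p => [|m IHm] v [|u p] //= /andP[avu up] [sp].
  apply/flatten_mapP; exists u; first exact: adj_rotation.
  by apply: map_f; apply: IHm.
apply: (@sub_finite_set _ _ [set` [seq (0, 0) :: p | p <- paths n (0, 0)]]);
  last exact: finite_seq.
move=> w [/and3P[/andP[/and3P[_ sw _] _] tw _] len _ _] /=.
case: w tw sw len => [|v w] //= /eqP[-> _] sw len.
by apply: map_f; apply: pathsP.
Qed.

End Directions.

(* Main.v *)
Require Import Defs.
From HB Require Import structures.
From mathcomp Require Import all_boot all_order all_algebra.
From mathcomp Require Import finmap.
From mathcomp Require Import all_classical all_reals all_analysis.
From mathcomp Require Import complex.
From mathcomp Require Import zify ring lra.

(** Since [ell (w) = - zeta ^ (winding w)], the identity says that, with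
    [z = zeta * y_ j] (so [z ^ 8 = -1]), the sum of [z ^ (winding w)] over the
    slit walks with [n + 1] edges is [(z + 1 / z) ^ n]: prolonging each walk by
    a left and a right turn multiplies the sum by [z + 1 / z], so it suffices
    that the prolongations which are no longer slit walks cancel. Those that
    exit into the slit have winding [4] or [-4] and are paired by the reflection
    in the x-axis; those that close a loop are paired by reversing the loop,
    which contributes [4] or [-4] to the winding; and [z ^ 4 + z ^ (-4) = 0].

    Both windings come from a discrete form of Hopf's proof of the Umlaufsatz:
    the turning of a path is compared with the turning of its secants
    [(v i, v j)], counted by the crossings of a ray, and the slit forces the
    secants from its points to have no crossings.

    For [j = 7] the sum is [(2 cos (pi / 8)) ^ n = x_c ^ (- n)], so the terms of
    the [G_(l,k) (x_c)] cannot all tend to [0]. *)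

Import Order.TTheory GRing.Theory Num.Theory.
Local Open Scope ring_scope.
Local Open Scope complex_scope.

(** * Crossings of secants and headings of edges *)

(* For [t - s] a unit vector, the number of crossings of the ray [x < 0],
   [y = - 1 / 2] from [s] to [t], counted positively downwards: the winding
   cocycle of the punctured lattice. *)
Definition crossing (s t : vertex) : int :=
  ((s.1 < 0) && (0 <= s.2))%R%:Z - ((s.1 < 0) && (0 <= t.2))%R%:Z.

Definition secant (x y : vertex) : vertex := (y.1 - x.1, y.2 - x.2).
(** A secant is turned by moving one end at a time along an edge, so that its difference vector
    makes the unit step that [crossing] expects. *)
Definition move_src (x x' y : vertex) := crossing (secant x y) (secant x' y).
Definition move_tgt (x y y' : vertex) := crossing (secant x y) (secant x y').

(** A half-open half-plane: for nonzero [s] it contains exactly one of [s] and its opposite. Its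
    border separates the ray of [crossing] from the opposite ray. *)
Definition upper (s : vertex) : bool :=
  (s.1 < 0) && (0 <= s.2) || (0 <= s.1) && (0 < s.2).

Definition even_vertex (v : vertex) : bool := (v.1 == v.2 %[mod 2])%Z.

(* The direction of the edge in units of [pi / 3], with values [-2], ..., [3]
   because of the cut along the ray of [crossing]. *)
Definition heading (u v : vertex) : int :=
  if u.1 < v.1 then 0 else if v.1 < u.1 then 3 else
  if u.2 < v.2 then (if even_vertex u then 2 else 1)
  else (if even_vertex u then -2 else -1).

Lemma vertex_eqE (u v : vertex) : (u == v) = (u.1 == v.1) && (u.2 == v.2).
Proof. by case: u v => [a b] [c d]. Qed.

Lemma adjE (u v : vertex) : adj u v =
  [|| (v.1 == u.1) && ((v.2 == u.2 + 1) || (v.2 == u.2 - 1)),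
      [&& v.1 == u.1 + 1, v.2 == u.2 & even_vertex u] |
      [&& v.1 == u.1 - 1, v.2 == u.2 & ~~ even_vertex u]].
Proof.
case: u v => [a b] [c d]; rewrite /adj /basic /even_vertex !vertex_eqE /=.
lia.
Qed.

Lemma adj_unit u v : adj u v -> [\/ v = (u.1, u.2 + 1), v = (u.1, u.2 - 1),
   v = (u.1 + 1, u.2) | v = (u.1 - 1, u.2)].
Proof.
case: u v => [a b] [c d]; rewrite adjE /= => /or3P[/andP[/eqP-> /orP[]/eqP->]|
  /and3P[/eqP-> /eqP-> _]|/and3P[/eqP-> /eqP-> _]].
- by constructor 1. - by constructor 2. - by constructor 3. - by constructor 4.
Qed.

Lemma adj_sym u v : adj u v = adj v u.
Proof. by rewrite /adj orbC. Qed.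

(** The four secants form a closed path of four unit steps that avoids the origin; such a path is
    too short to wind around it. *)
Lemma crossing_square x x' y y' : adj x x' -> adj y y' ->
  x != y -> x != y' -> x' != y -> x' != y' ->
  move_src x x' y + move_tgt x' y y' = move_tgt x y y' + move_src x x' y'.
Proof.
move=> /adj_unit hx /adj_unit hy; rewrite !vertex_eqE /move_src /move_tgt.
rewrite /crossing /secant.
case: x y hx hy => [a b] [c d] /=.
by case=> ->; case=> -> /=; lia.
Qed.

(** Reversing a secant replaces the ray by its opposite. Both rays count windings around the origin,
    so the two counts differ by a coboundary, that of the indicator of [upper]. *)
Lemma move_srcE x x' y : adj x x' -> x != y -> x' != y ->
  move_src x x' y =
  move_tgt y x x' + (upper (secant y x'))%:Z - (upper (secant y x))%:Z.
Proof.
move=> /adj_unit hx; rewrite !vertex_eqE /move_src /move_tgt /crossing /secant.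
rewrite /upper.
by case: x y hx => [a b] [c d]; case=> -> /=; lia.
Qed.

(** * Local turning at a vertex *)

Lemma prev3 (T : eqType) (x y z : T) : uniq [:: x; y; z] ->
  [/\ prev [:: x; y; z] x = z, prev [:: x; y; z] y = x
    & prev [:: x; y; z] z = y].
Proof.
rewrite /= !inE negb_or andbT => /andP[/andP[xy xz] yz].
by rewrite /prev /= !eqxx ![z == y]eq_sym ?(negbTE xy, negbTE xz, negbTE yz).
Qed.

Lemma rotation_even a b : even_vertex (a, b) ->
  rotation (a, b) = [:: (a + 1, b); (a, b + 1); (a, b - 1)].
Proof.
move=> ev; rewrite /rotation /= !adjE /= ev !eqxx !orbT /=.
have -> : (a - 1 == a) = false by lia.
have -> // : (a - 1 == a + 1) = false by lia.
Qed.

Lemma rotation_odd a b : ~~ even_vertex (a, b) ->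
  rotation (a, b) = [:: (a, b + 1); (a - 1, b); (a, b - 1)].
Proof.
move=> /[dup] ev /negbTE od; rewrite /rotation /= !adjE /= ev od !eqxx !orbT /=.
have -> : (a + 1 == a) = false by lia.
have -> : (a + 1 == a - 1) = false by lia.
done.
Qed.

Lemma rotation_uniq v : uniq (rotation v).
Proof. by rewrite filter_uniq //= !inE !vertex_eqE /=; lia. Qed.

Lemma mem_rotation u v : (u \in rotation v) = adj v u.
Proof.
rewrite mem_filter; case: (boolP (adj v u)) => //= /adj_unit.
by case=> ->; rewrite !inE !eqxx ?orbT.
Qed.

Lemma adj_even a b x : even_vertex (a, b) -> adj (a, b) x ->
  [\/ x = (a + 1, b), x = (a, b + 1) | x = (a, b - 1)].
Proof.
move=> ev; rewrite -mem_rotation rotation_even // !inE.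
by case/or3P=> /eqP ->; [constructor 1|constructor 2|constructor 3].
Qed.

Lemma adj_odd a b x : ~~ even_vertex (a, b) -> adj (a, b) x ->
  [\/ x = (a, b + 1), x = (a - 1, b) | x = (a, b - 1)].
Proof.
move=> ev; rewrite -mem_rotation rotation_odd // !inE.
by case/or3P=> /eqP ->; [constructor 1|constructor 2|constructor 3].
Qed.

(** Indicators replace the nested tests, which makes the case analyses below accessible to [lia]. *)
Lemma headingE u v : heading u v =
  3 * (v.1 < u.1)%R%:Z + 2 * [&& u.1 == v.1, u.2 < v.2 & even_vertex u]%R%:Z +
  [&& u.1 == v.1, u.2 < v.2 & ~~ even_vertex u]%R%:Z -
  2 * [&& u.1 == v.1, v.2 <= u.2 & even_vertex u]%R%:Z -
  [&& u.1 == v.1, v.2 <= u.2 & ~~ even_vertex u]%R%:Z.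
Proof.
rewrite /heading; case: (ltgtP u.1 v.1) => _;
  by case: (ltrP u.2 v.2); case: even_vertex.
Qed.

(** The secant from [x] to [v] becomes that from [v] to [y] by way of the secant from [x] to [y].
    The heading jumps by 6, a full turn, exactly when this passage crosses the ray, and the crossing
    terms undo the jump. *)
Lemma hook_weightE x v y : adj x v -> adj v y -> x != y ->
  hook_weight x v y =
  heading v y - heading x v + 6 * (move_tgt x v y + move_src x v y).
Proof.
have -> : hook_weight x v y = 2 * (y == prev (rotation v) x)%:Z - 1.
  by rewrite /hook_weight; case: (y == _).
rewrite adj_sym; case: v => a b.
have := rotation_uniq (a, b); rewrite !headingE.
rewrite /move_src /move_tgt /crossing /secant.
case: (boolP (even_vertex (a, b))) => [ev | od].
  rewrite rotation_even // => /prev3[p1 p2 p3].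
  move=> /(adj_even _ _ _ ev) hx /(adj_even _ _ _ ev) hy.
  move: hx hy ev; rewrite /even_vertex.
  by case=> ->; case=> ->; rewrite ?(p1, p2, p3) !vertex_eqE /=; lia.
rewrite rotation_odd // => /prev3[p1 p2 p3].
move=> /(adj_odd _ _ _ od) hx /(adj_odd _ _ _ od) hy.
move: hx hy od; rewrite /even_vertex.
by case=> ->; case=> ->; rewrite ?(p1, p2, p3) !vertex_eqE /=; lia.
Qed.

(** The finite check behind [loop_turning], over all placements of [p], [t], [u] around [s]. [B] is
    the number of crossings of the secants from [s] along a loop from [t] to [u], as forced by the
    loop not winding around [p]; it occurs once for each of the two sides in Hopf's argument. *)
Lemma loop_turning_local p s t u : adj s p -> adj s t -> adj s u ->
  p != t -> p != u -> t != u ->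
  let B := move_src s p t - move_tgt p s t - move_tgt p u s - move_src s p u in
  heading u s - heading p s + 6 * (move_tgt p s t + move_src p s t + B +
    (move_src s t u + move_tgt t u s) +
    (B + (upper (secant s u))%:Z - (upper (secant s t))%:Z))
  = - 4 * hook_weight p s t.
Proof.
move=> sp st su pt pu tu /=; rewrite hook_weightE // 1?adj_sym //.
move: sp st su pt pu tu; rewrite !headingE.
rewrite /move_src /move_tgt /crossing /upper /secant.
case: s => a b.
case: (boolP (even_vertex (a, b))) => [ev | od].
  move=> /(adj_even _ _ _ ev) hp /(adj_even _ _ _ ev) ht.
  move=> /(adj_even _ _ _ ev) hu.
  move: hp ht hu ev; rewrite /even_vertex.
  by case=> ->; case=> ->; case=> ->; rewrite !vertex_eqE /=; lia.
move=> /(adj_odd _ _ _ od) hp /(adj_odd _ _ _ od) ht.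
move=> /(adj_odd _ _ _ od) hu.
move: hp ht hu od; rewrite /even_vertex.
by case=> ->; case=> ->; case=> ->; rewrite !vertex_eqE /=; lia.
Qed.

(** * Secants along paths and the turning of loops *)

Lemma telescope_step (a b c d s e t : int) :
  a + b = c + d -> s + a = e + t -> s + c + d = e + (t + b).
Proof. lia. Qed.

(** The squares of [crossing_square] are glued into a strip along the path; the inner sides
    cancel. *)
Lemma move_src_path (v : nat -> vertex) x x' m : adj x x' ->
  (forall k, (k < m)%N -> adj (v k) (v k.+1)) ->
  (forall k, (k <= m)%N -> x != v k) -> (forall k, (k <= m)%N -> x' != v k) ->
  \sum_(k < m) move_tgt x (v k) (v k.+1) + move_src x x' (v m) =
  move_src x x' (v 0%N) + \sum_(k < m) move_tgt x' (v k) (v k.+1).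
Proof.
move=> xx'; elim: m => [|m IHm] adjv xv x'v; first by rewrite !big_ord0 addrC.
rewrite !big_ord_recr /=.
have := IHm (fun k km => adjv k (leqW km)) (fun k km => xv k (leqW km))
  (fun k km => x'v k (leqW km)).
have := @crossing_square x x' (v m) (v m.+1).
rewrite xx' adjv ?xv ?x'v // => /(_ isT isT isT isT isT isT).
exact: telescope_step.
Qed.

Lemma move_tgt_path (v : nat -> vertex) y y' m : adj y y' ->
  (forall k, (k < m)%N -> adj (v k) (v k.+1)) ->
  (forall k, (k <= m)%N -> v k != y) -> (forall k, (k <= m)%N -> v k != y') ->
  \sum_(k < m) move_src (v k) (v k.+1) y + move_tgt (v m) y y' =
  move_tgt (v 0%N) y y' + \sum_(k < m) move_src (v k) (v k.+1) y'.
Proof.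
move=> yy'; elim: m => [|m IHm] adjv vy vy'; first by rewrite !big_ord0 addrC.
rewrite !big_ord_recr /=.
have := IHm (fun k km => adjv k (leqW km)) (fun k km => vy k (leqW km))
  (fun k km => vy' k (leqW km)).
have := @crossing_square (v m) (v m.+1) y y'.
rewrite yy' adjv ?vy ?vy' // => /(_ isT isT isT isT isT isT)/esym.
exact: telescope_step.
Qed.

(* Hopf's trick: the direction of the secant from [v i] to [v j] makes the same
   total turn along both routes from [(0, 1)] to [(k, k.+1)]: the diagonal
   [j = i.+1], and first the side [i = 0], then the side [j = k.+1]. *)
Lemma hopf_secants (v : nat -> vertex) k :
  (forall i, (i <= k)%N -> adj (v i) (v i.+1)) ->
  (forall i j, (i < j <= k.+1)%N -> v i != v j) ->
  \sum_(i < k) (move_tgt (v i) (v i.+1) (v i.+2) +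
                move_src (v i) (v i.+1) (v i.+2)) =
  \sum_(j < k) move_tgt (v 0%N) (v j.+1) (v j.+2) +
  \sum_(i < k) move_src (v i) (v i.+1) (v k.+1).
Proof.
elim: k => [|k IHk] adjv injv; first by rewrite !big_ord0 addr0.
rewrite big_ord_recr /= IHk; last first.
- by move=> i j /andP[ij jk]; apply: injv; rewrite ij leqW.
- by move=> i ik; apply: adjv; exact: leqW.
have := @move_tgt_path v (v k.+1) (v k.+2) k.
rewrite adjv // => /(_ isT) H.
rewrite [in RHS]big_ord_recr [X in _ = _ + X]big_ord_recr /=.
have arith (a b c d e f : int) :
    b + c = e + f -> a + b + (c + d) = a + e + (f + d) by lia.
apply: arith.
apply: H => i ik.
- by apply: adjv; rewrite leqW // ltnW.
- by apply: injv; rewrite ltnS ik leqW.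
- by apply: injv; rewrite leqnn andbT; exact: leqW.
Qed.

Lemma sum_hook_weight (v : nat -> vertex) k :
  (forall i, (i <= k)%N -> adj (v i) (v i.+1)) ->
  (forall i, (i < k)%N -> v i != v i.+2) ->
  \sum_(i < k) hook_weight (v i) (v i.+1) (v i.+2) =
  heading (v k) (v k.+1) - heading (v 0%N) (v 1%N) +
  6 * \sum_(i < k) (move_tgt (v i) (v i.+1) (v i.+2) +
                    move_src (v i) (v i.+1) (v i.+2)).
Proof.
elim: k => [|k IHk] adjv nbk; first by rewrite !big_ord0; ring.
rewrite !big_ord_recr /= IHk; last first.
- by move=> i ik; apply: nbk; exact: leqW.
- by move=> i ik; apply: adjv; exact: leqW.
rewrite hook_weightE ?adjv ?nbk //; ring.
Qed.

Lemma sum_move_srcE (v : nat -> vertex) y m :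
  (forall i, (i < m)%N -> adj (v i) (v i.+1)) ->
  (forall i, (i <= m)%N -> y != v i) ->
  \sum_(i < m) move_src (v i) (v i.+1) y =
  \sum_(i < m) move_tgt y (v i) (v i.+1) +
  (upper (secant y (v m)))%:Z - (upper (secant y (v 0%N)))%:Z.
Proof.
elim: m => [|m IHm] adjv nv; first by rewrite !big_ord0; ring.
rewrite !big_ord_recr /= IHm; last first.
- by move=> i ik; apply: nv; exact: leqW.
- by move=> i ik; apply: adjv; exact: leqW.
rewrite move_srcE ?adjv // 1?eq_sym ?nv //; ring.
Qed.

(** The vanishing sum says that [p] is outside the loop. Entering by a left hook then means running
    clockwise: a full turn of -6, less the hook -1 at [v 0], leaves -5, and the entering hook adds
    1. The right case is symmetric. *)
Lemma loop_turning (v : nat -> vertex) p m : (1 < m)%N -> adj p (v 0%N) ->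
  (forall i, (i <= m)%N -> adj (v i) (v i.+1)) -> v m.+1 = v 0%N ->
  (forall i j, (i < j <= m)%N -> v i != v j) ->
  (forall i, (i <= m)%N -> p != v i) ->
  \sum_(i < m.+1) move_tgt p (v i) (v i.+1) = 0 ->
  hook_weight p (v 0%N) (v 1%N) +
    \sum_(i < m) hook_weight (v i) (v i.+1) (v i.+2) =
  - 4 * hook_weight p (v 0%N) (v 1%N).
Proof.
case: m => [//|[//|m]] _ pv adjv closed injv npv index0.
have av0 : adj (v 0%N) (v m.+2) by rewrite adj_sym -closed adjv.
rewrite -(loop_turning_local p (v 0%N) (v 1%N) (v m.+2)) ?npv ?adjv
  ?injv ?leqnn // 1?adj_sym //.
rewrite sum_hook_weight //; last first.
  move=> i; rewrite ltnS leq_eqVlt => /orP[/eqP ->|im].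
    by rewrite closed eq_sym injv ?leqnSn.
  apply: injv; lia.
rewrite hook_weightE ?npv ?adjv //.
(* The last term returns to [v 0]; it is split off because [hopf_secants] asks for distinct
   vertices. *)
rewrite big_ord_recr /= hopf_secants; last first.
- by move=> i j /andP[ij jm]; apply: injv; rewrite ij.
- by move=> i im; apply: adjv; rewrite leqW.
rewrite closed [\sum_(i < m.+1) move_src _ _ _]big_ord_recl /=.
have v0p : adj (v 0%N) p by rewrite adj_sym.
have vmv0 : adj (v m.+2) (v 0%N) by rewrite adj_sym.
(* Shifting the source from [v 0] to [p] expresses the secants from [v 0] through those from [p],
   whose total is known from [index0]. *)
have rowp := move_src_path (fun k => v k.+1) (v 0%N) p m.+1 v0p
  (fun i im => adjv i.+1 (ltnW im)) (fun i im => injv 0%N i.+1 im)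
  (fun i im => npv i.+1 im).
(* The secants into the last vertex are shifted to secants into [v 0]; reversed by [col0], these are
   again the secants from [v 0]. *)
have colm : \sum_(k < m) move_src (v k.+1) (v k.+2) (v m.+2) +
    move_tgt (v m.+1) (v m.+2) (v 0%N) = move_tgt (v 1%N) (v m.+2) (v 0%N) +
    \sum_(k < m) move_src (v k.+1) (v k.+2) (v 0%N).
  apply: (move_tgt_path (fun k => v k.+1)) => // i im.
  - by apply: adjv; lia.
  - by apply: injv; lia.
  - by rewrite eq_sym; apply: injv; lia.
have col0 := sum_move_srcE (fun k => v k.+1) (v 0%N) m.+1
  (fun i im => adjv i.+1 (ltnW im)) (fun i im => injv 0%N i.+1 im).
rewrite [X in X = _]big_ord_recr /= in col0.
move: index0; rewrite big_ord_recr big_ord_recl /= closed => index0.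
have arith (h1 hp hm a b B M0 SM c d e f g k u1 u2 RP S0 : int) :
    a + RP + f = 0 -> B + g = e + RP -> SM + c = k + S0 ->
    S0 + d = B + u1 - u2 ->
    h1 - hp + 6 * (a + b) + (hm - h1 + 6 * (B + (M0 + SM) + (c + d))) =
    hm - hp + 6 * (a + b + (e - a - f - g) + (M0 + k) +
                   ((e - a - f - g) + u1 - u2)) by lia.
exact: arith index0 rowp colm col0.
Qed.

(** * Turning of walks in the slit plane *)

(** Seen from the origin, the ray of [crossing] runs inside the slit, so no edge of the slit plane
    meets it. *)
Lemma slit_move_tgt0 u v : slit_plane u -> slit_plane v -> adj u v ->
  move_tgt (0, 0) u v = 0.
Proof.
rewrite /slit_plane /move_tgt /crossing /secant => su sv /adj_unit.
by case: u su => a b /= su; case => vE; move: sv; rewrite vE /=; lia.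
Qed.

(** The loop does not wind around the origin by [slit_move_tgt0]. This index stays 0 along the
    stick, which avoids the loop: by [move_src_path], whose two end terms agree on a closed path. So
    [loop_turning] applies at the last vertex of the stick. *)
Lemma lollipop_turning (v : nat -> vertex) i0 m : (1 < m)%N ->
  v 0%N = (0, 0) ->
  (forall i, (i <= i0.+1 + m)%N -> adj (v i) (v i.+1)) ->
  (forall i, (0 < i <= i0.+1 + m)%N -> slit_plane (v i)) ->
  (forall i j, (i < j <= i0.+1 + m)%N -> v i != v j) ->
  v (i0.+1 + m).+1 = v i0.+1 ->
  \sum_(i < m.+1) hook_weight (v (i0 + i)%N) (v (i0 + i).+1) (v (i0 + i).+2) =
  - 4 * hook_weight (v i0) (v i0.+1) (v i0.+2).
Proof.
move=> m1 v0 adjv slitv injv closed.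
pose s k := v (i0.+1 + k)%N.
have adjs i : (i <= m)%N -> adj (s i) (s i.+1).
  by move=> im; rewrite /s addnS; apply: adjv; rewrite leq_add2l.
have closeds : s m.+1 = s 0%N by rewrite /s addnS closed addn0.
have vs j k : (j <= i0)%N -> (k <= m.+1)%N -> v j != s k.
  move=> ji; rewrite leq_eqVlt => /orP[/eqP->|km].
    by rewrite closeds /s addn0 injv // ltnS ji leq_addr.
  by apply: injv; lia.
have index0 j : (j <= i0)%N ->
    \sum_(k < m.+1) move_tgt (v j) (s k) (s k.+1) = 0.
  elim: j => [_|j IHj ji].
    rewrite v0; apply: big1 => -[k km] _ /=.
    apply: slit_move_tgt0; last exact: adjs.
      by apply: slitv; lia.
    have [->|km'] := eqVneq k m; first by rewrite closeds; apply: slitv; lia.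
    by apply: slitv; lia.
  have jj : adj (v j) (v j.+1) by apply: adjv; lia.
  have := @move_src_path s (v j) (v j.+1) m.+1 jj adjs
    (fun k => vs j k (ltnW ji)) (fun k => vs j.+1 k ji).
  rewrite closeds IHj; last exact: ltnW.
  have arith (a b : int) : 0 + a = a + b -> b = 0 by lia.
  exact: arith.
have ps : adj (v i0) (s 0%N) by rewrite /s addn0; apply: adjv; lia.
have s0 : s 0%N = v i0.+1 by rewrite /s addn0.
have s1 : s 1%N = v i0.+2 by rewrite /s addn1.
rewrite -s1 -s0 -(@loop_turning s (v i0) m m1 ps adjs closeds) //; last first.
- exact: index0.
- by move=> i im; apply: vs => //; exact: leqW.
- by move=> i j ij; apply: injv; lia.
rewrite big_ord_recl /= addn0 s0 s1; congr (_ + _).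
apply: eq_bigr => i _; rewrite /bump leq0n /s.
by congr hook_weight; congr v; lia.
Qed.

(** The slit widens to the west, so the westward half-line from a vertex [w] of its border stays in
    it, while an edge crossing the ray based at [w] would have an end on this half-line. *)
Lemma slit_boundary_move_tgt0 w u v : w.1 <= 0 ->
  w.2 = 1 - w.1 \/ w.2 = w.1 - 1 ->
  slit_plane u -> slit_plane v -> adj u v -> move_tgt w u v = 0.
Proof.
rewrite /slit_plane /move_tgt /crossing /secant.
case: w => c d /= c0 dE su sv /adj_unit.
by case: u su => a b /= su; case => vE; move: sv; rewrite vE /=; case: dE; lia.
Qed.

(** The border vertices on the two diagonals are odd: their horizontal edge points west into the
    slit, and they can be entered from outside only vertically. *)
Lemma slit_exit u w : slit_plane u -> ~~ slit_plane w -> adj u w ->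
  w != (0, 0) -> w.1 <= 0 /\
    (w.2 = 1 - w.1 /\ u = (w.1, w.2 + 1) \/
     w.2 = w.1 - 1 /\ u = (w.1, w.2 - 1)).
Proof.
case: u w => [a b] [c d]; rewrite adjE vertex_eqE /slit_plane /even_vertex /=.
move=> su sw uw w0; split; first by lia.
have ac : a = c by lia.
have [bE|bE] : b = d + 1 \/ b = d - 1 by lia.
  by left; rewrite ac bE; split; first lia.
by right; rewrite ac bE; split; first lia.
Qed.

(** Neither side in Hopf's argument has crossings: not the secants from the origin, nor, once
    reversed, those into the exit vertex. What remains is the last heading and the correction by
    [upper]: -2 + 6 above the axis, 2 - 6 below. *)
Lemma exit_turning (v : nat -> vertex) n :
  v 0%N = (0, 0) -> v 1%N = (1, 0) ->
  (forall i, (i <= n)%N -> adj (v i) (v i.+1)) ->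
  (forall i, (0 < i <= n)%N -> slit_plane (v i)) ->
  (forall i j, (i < j <= n)%N -> v i != v j) ->
  ~~ slit_plane (v n.+1) -> v n.+1 != (0, 0) ->
  \sum_(i < n) hook_weight (v i) (v i.+1) (v i.+2) =
  if 0 < (v n.+1).2 then 4 else - 4.
Proof.
move=> v0 v1 adjv slitv injv exit exit0.
have n0 : (0 < n)%N.
  by rewrite lt0n; apply: contraTneq exit => ->; rewrite v1.
have [wle wE] : (v n.+1).1 <= 0 /\
    ((v n.+1).2 = 1 - (v n.+1).1 /\ v n = ((v n.+1).1, (v n.+1).2 + 1) \/
     (v n.+1).2 = (v n.+1).1 - 1 /\ v n = ((v n.+1).1, (v n.+1).2 - 1)).
  by apply: slit_exit => //; [apply: slitv; rewrite n0 /=|apply: adjv].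
have injv' i j : (i < j <= n.+1)%N -> v i != v j.
  rewrite [(j <= _)%N]leq_eqVlt => /andP[ij /orP[/eqP jn|jn]];
    last by apply: injv; lia.
  rewrite jn; case: i ij => [|i] ij; first by rewrite v0 eq_sym.
  by apply: contraNneq exit => <-; apply: slitv; lia.
rewrite sum_hook_weight //; last by move=> i im; apply: injv'; lia.
rewrite hopf_secants //.
rewrite (@sum_move_srcE v (v n.+1) n); last first.
- by move=> i im; rewrite eq_sym; apply: injv'; lia.
- by move=> i im; apply: adjv; lia.
rewrite !big1 => [|[i im] _|[i im] _] /=.
- rewrite v0 v1; case: (v n.+1) (v n) wE wle => c d [a b] /=.
  rewrite /upper /secant !headingE /even_vertex.
  by case=> [[dE [-> ->]]|[dE [-> ->]]] c0 /=; case: ifPn; lia.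
- case: i im => [|i] im.
    (* [v 0] lies in the slit, but the first edge is horizontal and cannot cross a horizontal
       ray. *)
    by rewrite v0 v1 /move_tgt /crossing /secant /=; lia.
  apply: slit_boundary_move_tgt0 => //; first by case: wE; tauto.
  + by apply: slitv; lia.
  + by apply: slitv; lia.
  + by apply: adjv; lia.
(* The last step ends in the slit and is checked directly: it is vertical and stays on one side of
   the axis. *)
- rewrite v0; have [in_|in_] := eqVneq i.+1 n.
    rewrite in_; case: (v n.+1) (v n) wE wle => c d [a b] /=.
    rewrite /move_tgt /crossing /secant.
    by case=> [[dE [-> ->]]|[dE [-> ->]]] c0 /=; lia.
  apply: slit_move_tgt0; [apply: slitv; lia..|apply: adjv; lia].
Qed.

(** * Enumeration of slit walks and windings of their prolongations *)

Lemma hook_weight_other x v y y' : adj v x -> adj v y -> adj v y' ->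
  x != y -> x != y' -> y != y' -> hook_weight x v y' = - hook_weight x v y.
Proof.
case: v => a b; rewrite -!mem_rotation /hook_weight.
have := rotation_uniq (a, b).
by case: (boolP (even_vertex (a, b))) => [/rotation_even|/rotation_odd] ->
  /[dup] un /prev3[p1 p2 p3]; rewrite !inE => /or3P[]/eqP-> /or3P[]/eqP->
  /or3P[]/eqP->; rewrite ?eqxx // ?p1 ?p2 ?p3 => _ _ _;
  rewrite !vertex_eqE /=; do 2! case: ifPn; lia.
Qed.

Lemma hook_weight_sign x v y : hook_weight x v y = 1 \/ hook_weight x v y = -1.
Proof. by rewrite /hook_weight; case: ifP; [left|right]. Qed.

(** Distinct vertices already exclude backtracks, so that test drops out. *)
Lemma slit_sawE w : slit_saw w = [&& (1 < size w)%N, sorted adj w, uniq w,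
  take 2 w == [:: (0, 0); (1, 0)] & all slit_plane (behead w)].
Proof.
rewrite /slit_saw /is_saw /is_walk -!andbA; do 2! congr (_ && _).
case: (boolP (uniq w)) => [uw|]; last by rewrite andbF.
rewrite (_ : all _ _ = true) //; apply/(all_nthP ((0, 0), (0, 0))) => i.
rewrite size_zip size_drop leq_min => /andP[i1 i2].
rewrite nth_zip_cond size_zip size_drop leq_min i1 i2 /= nth_drop nth_uniq //.
  by lia.
by rewrite -ltn_subRL.
Qed.

Lemma slit_saw_rcons w u : slit_saw w -> adj (last (0, 0) w) u ->
  slit_saw (rcons w u) = (u \notin w) && slit_plane u.
Proof.
rewrite !slit_sawE => /and5P[sw adjw uw tw slitw] au.
rewrite size_rcons leqW //= rcons_uniq uw andbT.
case: w sw adjw uw tw slitw au => [|x [|y w]] //= _ adjw _ tw slitw au.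
case/andP: adjw => xy yw; case/andP: slitw => sy sw.
rewrite rcons_path all_rcons xy yw au sy sw andbT; rewrite take0 in tw *.
by rewrite take0 tw /= andbT.
Qed.

Definition extensions (w : seq vertex) : seq (seq vertex) :=
  [seq rcons w u | u <- rotation (last (0, 0) w)
                 & u != nth (0, 0) w (size w).-2].

(** The index is shifted: the entries have [n.+1] edges and [n.+2] vertices, the first edge being
    prescribed. *)
Fixpoint slit_saws (n : nat) : seq (seq vertex) :=
  if n is n'.+1 then
    [seq w <- flatten [seq extensions w | w <- slit_saws n'] | slit_saw w]
  else [:: [:: (0, 0); (1, 0)]].

Lemma mem_extensions w b : reflect
  (exists u, [/\ b = rcons w u, adj (last (0, 0) w) u
               & u != nth (0, 0) w (size w).-2]) (b \in extensions w).
Proof.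
apply: (iffP mapP) => [[u]|[u [-> au bu]]].
  by rewrite mem_filter mem_rotation => /andP[bu au] ->; exists u.
by exists u; rewrite // mem_filter mem_rotation bu.
Qed.

Lemma mem_slit_saws n w : (w \in slit_saws n) = slit_saw w && (size w == n.+2).
Proof.
elim: n w => [|n IHn] w.
  rewrite inE slit_sawE; case: w => [|x [|y [|z w]]] //=; rewrite ?andbF //;
    do ?by apply/eqP; case.
  by apply/idP/idP => [/eqP[-> ->]|/andP[/and4P[_ _ /eqP[-> ->]]]].
rewrite mem_filter; case: (boolP (slit_saw w)) => //= sw.
apply/flatten_mapP/idP => [[w']|].
  rewrite IHn => /andP[_ /eqP sz] /mem_extensions[u [-> _ _]].
  by rewrite size_rcons sz.
case/lastP: w sw => [//|w u] sw; rewrite size_rcons eqSS => /eqP sz.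
exists w.
  rewrite IHn sz eqxx andbT; move: sw; rewrite !slit_sawE sz.
  case/and5P=> _ adjw; rewrite rcons_uniq => /andP[_ ->].
  case: w sz adjw => [|x [|y w]] //= _; rewrite rcons_path all_rcons.
  by move=> /and3P[-> -> _] /=; rewrite !take0 => -> /and3P[-> _ ->].
apply/mem_extensions; exists u; split=> //.
  move: sw; rewrite slit_sawE => /and5P[_ + _ _ _].
  by case: w sz => [|x w] //= _; rewrite rcons_path => /andP[].
move: sw; rewrite slit_sawE => /and5P[_ _ + _ _].
rewrite rcons_uniq => /andP[uw _]; apply: contraNneq uw => ->.
by rewrite mem_nth // sz.
Qed.

Lemma extensions_uniq n :
  uniq (flatten [seq extensions w | w <- slit_saws n]).
Proof.
have step (s : seq (seq vertex)) :
    uniq s -> uniq (flatten [seq extensions w | w <- s]).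
  move=> us; apply: allpairs_uniq_dep => // [w _|].
    exact/filter_uniq/rotation_uniq.
  by move=> [w u] [w' u'] _ _ /= /rcons_inj[-> ->].
by apply: (step); elim: n => //= n IHn; apply/filter_uniq/step.
Qed.

Lemma winding_rcons w u : (1 < size w)%N -> winding (rcons w u) =
  winding w + hook_weight (nth (0, 0) w (size w).-2) (last (0, 0) w) u.
Proof.
case: w => [|x [|y w]] //= _.
have nthE k : (k <= size w)%N ->
    nth (0, 0) (y :: rcons w u) k = nth (0, 0) (y :: w) k.
  by move=> kw; rewrite -rcons_cons nth_rcons /= ltnS kw.
rewrite /winding /= size_rcons !subSS !subn0 big_ord_recr /=; congr (_ + _).
  apply: eq_bigr => -[i im] _ /=.
  congr hook_weight.
  - by case: i im => [//|i] im; apply: nthE; exact: ltnW (ltnW im).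
  - by apply: nthE; exact: ltnW.
  - by rewrite nth_rcons im.
congr hook_weight.
- by case: (w) nthE => [//|z w'] nthE; apply: nthE; exact: leqnSn.
- by rewrite nthE //; exact: nth_last _ (y :: w).
- by rewrite nth_rcons ltnn eqxx.
Qed.

(** [lollipop_turning] for the stick [P] and the loop [u :: M]; the stick is nonempty because the
    first vertex is not in the slit plane. *)
Lemma winding_loop P u M : (1 < size M)%N ->
  slit_saw (P ++ u :: M) -> adj (last u M) u -> slit_plane u ->
  winding (rcons (P ++ u :: M) u) =
  winding (rcons P u) - 4 * hook_weight (last (0, 0) P) u (head u M).
Proof.
move=> M1; rewrite slit_sawE => /and5P[_ adjw uw tw slitw] lu slitu.
case: P => [|x P] in adjw uw tw slitw *.
  case: M M1 => [//|y M] _ in adjw uw tw slitw lu *.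
  case/eqP: tw => u0 _ _; by rewrite u0 in slitu.
pose v : nat -> vertex := nth (0, 0) (rcons ((x :: P) ++ u :: M) u).
have vl i : (i < (size P).+2 + size M)%N ->
    v i = nth (0, 0) ((x :: P) ++ u :: M) i.
  by move=> im; rewrite /v nth_rcons size_cat /= addnS -addSn im.
have vP i : (i < (size P).+1)%N -> v i = nth (0, 0) (x :: P) i.
  move=> im; rewrite vl ?nth_cat ?[X in (_ < X)%N]/= ?im //.
  exact/ltn_addr/leqW.
have vu : v (size P).+1 = u.
  by rewrite vl ?nth_cat ?[X in (_ < X)%N]/= ?ltnn ?subnn // ltn_addr.
have vM i : (i < size M)%N -> v ((size P).+2 + i)%N = nth (0, 0) M i.
  move=> im; rewrite vl ?ltn_add2l // nth_cat /= addSn ltnNge.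
  rewrite leqW ?leq_addr //=.
  by rewrite -addnS addKn.
have vend : v ((size P).+1 + size M).+1 = u.
  by rewrite /v nth_rcons size_cat /= addnS ltnn eqxx.
have -> : winding (rcons ((x :: P) ++ u :: M) u) =
   \sum_(i < size P + (size M).+1) hook_weight (v i) (v i.+1) (v i.+2).
  by rewrite /winding size_rcons size_cat /= !subSS subn0.
rewrite big_split_ord /=.
rewrite lollipop_turning //.
- rewrite mulNr; congr (_ - _ * hook_weight _ _ _).
  + rewrite /winding /= size_rcons !subSS subn0.
    apply: eq_bigr => -[i im] _ /=.
    congr hook_weight.
    * by rewrite vP ?leqW // -rcons_cons nth_rcons /= leqW.
    * by rewrite vP // nth_rcons im.
    * rewrite nth_rcons; case: (ltngtP i.+1 (size P)) => [iP|iP|->].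
      - by rewrite vP.
      - by rewrite ltnNge im in iP.
      - by rewrite vu.
  + by rewrite vP //; exact: nth_last _ (x :: P).
  + exact: vu.
  + by rewrite -[X in v X]addn0 vM ?(ltnW M1) // nth0; case: (M) M1.
- rewrite vP //; case: (P) tw => [|y P'] /eqP[] //=.
- have adjb : sorted adj (rcons ((x :: P) ++ u :: M) u).
    by rewrite /= rcons_path last_cat /= lu andbT.
  move=> i im; apply: (sortedP (0, 0) adjb).
  by rewrite size_rcons size_cat /= addnS -addSn ltnS.
- move=> i /andP[i0 im]; rewrite vl //.
  case: i i0 im => // i _ im; rewrite -nth_behead.
  by apply: (all_nthP (0, 0) slitw); rewrite size_behead size_cat /= addnS.
- move=> i j /andP[ij jm]; rewrite !vl ?nth_uniq ?size_cat //= ?addnS //.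
  + by rewrite neq_ltn ij.
  + exact: leq_trans (ltnW ij) jm.
  + exact: leq_trans (ltnW ij) jm.
- by rewrite vend vu.
Qed.

Lemma slit_nbr_origin u : slit_plane u -> adj u (0, 0) -> u = (1, 0).
Proof.
case: u => c d; rewrite adjE /slit_plane /even_vertex /= => scd acd.
by apply/eqP; rewrite vertex_eqE /=; lia.
Qed.

(** From the slit plane the origin is reached only through (1, 0). A self-avoiding [w] ends there
    only if it is the single edge, and then the step is a backtrack. *)
Lemma slit_saw_step_neq0 w u : slit_saw w -> adj (last (0, 0) w) u ->
  u != nth (0, 0) w (size w).-2 -> u != (0, 0).
Proof.
rewrite slit_sawE => /and5P[sw adjw uw tw slitw] au bu.
apply: contraNneq bu => u0; rewrite u0.
case: w sw adjw uw tw slitw au => [|x [|y w]] //= _ adjw uw.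
rewrite take0 => /eqP[x0 y0] slitw au.
case: w adjw uw slitw au => [|z w] /= adjw uw slitw au; first by rewrite x0.
have zw : last z w = (1, 0).
  apply: slit_nbr_origin; last by rewrite -u0.
  by case/andP: slitw => _ /(@allP _ _ (z :: w)); apply; rewrite mem_last.
by move: uw; rewrite y0 -zw mem_last andbF.
Qed.

Lemma winding_exit w u : slit_saw w -> adj (last (0, 0) w) u ->
  u != nth (0, 0) w (size w).-2 -> ~~ slit_plane u ->
  winding (rcons w u) = if 0 < u.2 then 4 else - 4.
Proof.
move=> /[dup] slw; rewrite slit_sawE => /and5P[sw adjw uw tw slitw] au bu nu.
have u0 := slit_saw_step_neq0 _ _ slw au bu.
clear slw; case: w sw adjw uw tw slitw au bu => [|x [|y w]] //= _ adjw uw.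
rewrite take0 => /eqP[x0 y0] slitw au bu.
pose b := rcons [:: x, y & w] u.
pose v : nat -> vertex := nth (0, 0) b.
have vl i : (i < (size w).+2)%N -> v i = nth (0, 0) [:: x, y & w] i.
  by move=> im; rewrite /v nth_rcons /= im.
have vu : v (size w).+2 = u by rewrite /v nth_rcons /= ltnn eqxx.
have -> : winding (rcons [:: x, y & w] u) =
   \sum_(i < (size w).+1) hook_weight (v i) (v i.+1) (v i.+2).
  by rewrite /winding size_rcons /= !subSS subn0.
have adjb : sorted adj b.
  by case/andP: adjw => xy yw; rewrite /= rcons_path xy yw.
have vlast : v (size w).+1 = last y w.
  by rewrite vl //; exact: nth_last _ (y :: w).
rewrite exit_turning ?vu //.
- by move=> i im; apply: (sortedP (0, 0) adjb); rewrite size_rcons /= !ltnS.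
- move=> i /andP[i0 im]; rewrite vl //.
  case: i i0 im => // i _ im.
  exact: (all_nthP (0, 0) (slitw : all slit_plane (y :: w))).
- move=> i j /andP[ij jm]; rewrite !vl ?nth_uniq //=.
  + by rewrite neq_ltn ij.
  + exact: leq_trans (ltnW ij) jm.
  + exact: leq_trans (ltnW ij) jm.
Qed.

(** * The involution on spoilt walks *)

Definition reflect_vertex (v : vertex) : vertex := (v.1, - v.2).

Lemma reflect_vertexK : involutive reflect_vertex.
Proof. by case=> a b; rewrite /reflect_vertex /= opprK. Qed.

Lemma adj_reflect u v : adj (reflect_vertex u) (reflect_vertex v) = adj u v.
Proof.
case: u v => a b [c d]; rewrite !adjE /reflect_vertex /even_vertex /=; lia.
Qed.

Lemma slit_plane_reflect v : slit_plane (reflect_vertex v) = slit_plane v.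
Proof. case: v => a b; rewrite /slit_plane /reflect_vertex /=; lia. Qed.

Lemma slit_saw_reflect w : slit_saw w -> slit_saw (map reflect_vertex w).
Proof.
rewrite !slit_sawE => /and5P[sw adjw uw tw slitw].
rewrite size_map sw map_inj_uniq ?uw; last exact: inv_inj reflect_vertexK.
have r2 : map reflect_vertex [:: (0, 0); (1, 0)] = [:: (0, 0); (1, 0)] by [].
rewrite -map_take (eqP tw) r2 eqxx andTb.
rewrite behead_map all_map (eq_all slit_plane_reflect) slitw andbT.
by rewrite sorted_map (eq_sorted adj_reflect) andbT.
Qed.

(* The slit walks that have just been prolonged by a step which runs into the
   slit or into the walk itself. *)
Definition spoilt n := [seq b <- flatten [seq extensions w | w <- slit_saws n]
                        | ~~ slit_saw b].

(** A spoilt walk whose last vertex [u] is in the slit plane has already visited [u], and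
    [index u w] is where its loop starts. *)
Definition flip (b : seq vertex) : seq vertex :=
  let u := last (0, 0) b in
  let w := take (size b).-1 b in
  if slit_plane u then
    rcons (take (index u w).+1 w ++ rev (drop (index u w).+1 w)) u
  else map reflect_vertex b.

Lemma mem_spoilt n b : reflect (exists w u, [/\ b = rcons w u,
   [/\ slit_saw w & size w = n.+2], adj (last (0, 0) w) u,
   u != nth (0, 0) w (size w).-2 & (u \in w) || ~~ slit_plane u])
  (b \in spoilt n).
Proof.
rewrite mem_filter; apply: (iffP andP) => [[sb]|].
  case/flatten_mapP=> w; rewrite mem_slit_saws => /andP[sw /eqP szw].
  case/mem_extensions=> u [bE au bu]; exists w, u; split=> //.
  by move: sb; rewrite bE slit_saw_rcons // negb_and negbK.
case=> w [u [-> [sw szw] au bu uE]]; rewrite slit_saw_rcons // negb_and negbK.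
split=> //; apply/flatten_mapP; exists w.
  by rewrite mem_slit_saws sw szw /=.
by apply/mem_extensions; exists u.
Qed.

(** Reflection exchanges the two sides of the slit, so [winding_exit] gives the form below with
    [r = 0]; the form is shared with [flip_loop]. *)
Lemma flip_exit n w u : slit_saw w -> size w = n.+2 ->
  adj (last (0, 0) w) u -> u != nth (0, 0) w (size w).-2 -> ~~ slit_plane u ->
  [/\ flip (rcons w u) \in spoilt n, flip (flip (rcons w u)) = rcons w u &
      exists r e : int, [/\ (e = 1 \/ e = -1), winding (rcons w u) = r + 4 * e &
                     winding (flip (rcons w u)) = r - 4 * e]].
Proof.
move=> sw szw au bu nu; rewrite {2}/flip.
have fE : flip (rcons w u) = rcons (map reflect_vertex w) (reflect_vertex u).
  by rewrite /flip last_rcons (negbTE nu) map_rcons.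
have nu' : ~~ slit_plane (reflect_vertex u) by rewrite slit_plane_reflect.
have au' : adj (last (0, 0) (map reflect_vertex w)) (reflect_vertex u).
  case: w szw sw au {bu fE} => [//|x w] /= szw sw au.
  by rewrite last_map adj_reflect.
have bu' : reflect_vertex u !=
    nth (0, 0) (map reflect_vertex w) (size (map reflect_vertex w)).-2.
  rewrite size_map (nth_map (0, 0)); last by rewrite szw.
  by rewrite (inv_eq reflect_vertexK) reflect_vertexK.
split.
- rewrite fE; apply/mem_spoilt.
  exists (map reflect_vertex w), (reflect_vertex u).
  split=> //; last by rewrite nu' orbT.
  by rewrite size_map; split; first exact: slit_saw_reflect.
- rewrite fE last_rcons (negbTE nu') -map_rcons -map_comp map_id_in // => x _.
  exact: reflect_vertexK.
- rewrite fE !winding_exit ?slit_saw_reflect //.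
  have [u0|u0] : 0 < u.2 \/ u.2 < 0.
    have lslit : slit_plane (last (0, 0) w).
      move: sw; rewrite slit_sawE => /and5P[_ _ _ _ /allP slitw].
      by case: (w) szw slitw => [|x [|y w']] //= _; apply; rewrite mem_last.
    have u00 := slit_saw_step_neq0 _ _ sw au bu.
    have [c0] := slit_exit _ _ lslit nu au u00; lia.
  + exists 0, 1; rewrite u0 /= ifF; last by lia.
    by split; [left|..].
  + exists 0, (-1); rewrite ifF; last by lia.
    rewrite /= ifT; last by lia.
    by split; [right|..].
Qed.

Lemma flip_loopE P u M : u \notin P -> slit_plane u ->
  flip (rcons (P ++ u :: M) u) = rcons (P ++ u :: rev M) u.
Proof.
move=> uP su; rewrite /flip last_rcons su size_rcons /=.
have -> : take (size (P ++ u :: M)) (rcons (P ++ u :: M) u) = P ++ u :: M.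
  by rewrite -cats1 take_size_cat.
rewrite index_cat (negbTE uP) index_head addn0 -cat_rcons.
by rewrite take_size_cat ?drop_size_cat ?size_rcons // cat_rcons.
Qed.

(** The closing edge of the loop becomes the first edge of the reversed loop. *)
Lemma slit_saw_reverse P u M : P != [::] -> slit_saw (P ++ u :: M) ->
  adj (last u M) u -> slit_saw (P ++ u :: rev M).
Proof.
case: P => [//|x P] _; rewrite !slit_sawE => /and5P[sw adjw uw tw slitw] au.
have pMM : perm_eq ((x :: P) ++ u :: rev M) ((x :: P) ++ u :: M).
  by rewrite perm_cat2l perm_cons perm_rev.
rewrite (perm_size pMM) sw (perm_uniq pMM) uw /=; apply/and3P; split.
- move: adjw; rewrite /= !cat_path /= => /and3P[-> -> pM] /=.
  have : sorted adj (rcons M u).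
    case: (M) pM au => [//|m M'] /= /andP[_ pM] au.
    by rewrite rcons_path pM.
  rewrite -(eq_sorted (fun x y => adj_sym y x)) -rev_sorted rev_rcons.
  by [].
- by case: (P) tw => [|y P'] /=; rewrite !take0.
- rewrite (_ : all _ _ = all slit_plane (P ++ u :: M)) //.
  by apply: perm_all; rewrite perm_cat2l perm_cons perm_rev.
Qed.

(** Reversal keeps the stick [P] and exchanges the two loop edges at [u], so the entering hook
    changes sign, and with it the loop term in [winding_loop]. *)
Lemma flip_loop n w u : slit_saw w -> size w = n.+2 ->
  adj (last (0, 0) w) u -> u != nth (0, 0) w (size w).-2 -> u \in w ->
  slit_plane u ->
  [/\ flip (rcons w u) \in spoilt n, flip (flip (rcons w u)) = rcons w u &
      exists r e : int, [/\ (e = 1 \/ e = -1), winding (rcons w u) = r + 4 * e &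
                     winding (flip (rcons w u)) = r - 4 * e]].
Proof.
move=> sw szw au bu uw su; case/splitPr: uw => P M in sw szw au bu *.
have := sw; rewrite slit_sawE => /and5P[_ adjw uw tw _].
have P0 : P != [::].
  apply: contraTneq su => P0; move: tw; rewrite P0.
  by case: (M) => [|m M'] //= /eqP[-> _].
have [uP uM] : u \notin P /\ u \notin M.
  move: uw; rewrite cat_uniq /= => /and3P[_ /norP[-> _] /andP[-> _]].
  by [].
rewrite last_cat /= in au.
(* An empty [M] would make [u] adjacent to itself, a single vertex would make the last step a
   backtrack. *)
have M1 : (1 < size M)%N.
  case: (M) au bu => [|m [|m' M']] //=.
    by rewrite adjE; lia.
  by rewrite size_cat /= addn2 /= nth_cat !ltnn subnn /= eqxx.
have saw' := slit_saw_reverse _ _ _ P0 sw au.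
have sM : size (P ++ u :: rev M) = size (P ++ u :: M).
  by rewrite !size_cat /= size_rev.
have au' : adj (last u (rev M)) u.
  move: adjw; case: (P) P0 => [//|x P'] _; rewrite /= cat_path /=.
  case: (M) M1 => [//|m M'] _ /=; rewrite rev_cons last_rcons.
  by case/and4P=> _ _ um _; rewrite adj_sym.
have bu' : u != nth (0, 0) (P ++ u :: rev M) (size (P ++ u :: rev M)).-2.
  have uE : nth (0, 0) (P ++ u :: rev M) (size P) = u.
    by rewrite nth_cat ltnn subnn.
  rewrite -{1}uE nth_uniq.
  - rewrite size_cat /= size_rev; case: (size M) M1 => [|[|k]] // _.
    by rewrite !addnS /= neq_ltn ltnS leq_addr.
  - by rewrite size_cat /= addnS ltnS leq_addr.
  - by rewrite sM szw /= ltnW.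
  - by move: saw'; rewrite slit_sawE => /and5P[].
rewrite !flip_loopE // revK; split=> //.
  apply/mem_spoilt; exists (P ++ u :: rev M), u; split=> //.
  - by rewrite sM szw.
  - by rewrite last_cat.
  - by rewrite mem_cat mem_head orbT.
exists (winding (rcons P u)), (- hook_weight (last (0, 0) P) u (head u M)).
rewrite !winding_loop ?size_rev //; split.
- by case: (hook_weight_sign (last (0, 0) P) u (head u M)) => ->; [right|left].
- by rewrite mulrN.
- have -> : hook_weight (last (0, 0) P) u (head u (rev M)) =
      - hook_weight (last (0, 0) P) u (head u M).
    have /andP[lPu um] : adj (last (0, 0) P) u && adj u (head u M).
      move: adjw; case: (P) P0 => [//|x P'] _; rewrite /= cat_path /=.
      by case: (M) M1 => [//|m M'] _ /= /and4P[_ -> ->].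
    have -> : head u (rev M) = last u M.
      by case/lastP: (M) => //= ? ?; rewrite rev_rcons last_rcons.
    have hM : head u M \in M by case: (M) M1 => // m M' _; exact: mem_head.
    have lM : last u M \in M.
      by case: (M) M1 => // m M' _; rewrite /= mem_last.
    have lPP : last (0, 0) P \in P.
      by case: (P) P0 => // x P' _; rewrite /= mem_last.
    move: uw; rewrite cat_uniq => /and3P[_ /hasPn PM /andP[_ uM']].
    apply: hook_weight_other => //.
    - by rewrite adj_sym.
    - by rewrite adj_sym.
    - apply/eqP => PE; move: lPP; rewrite PE; apply/negP/PM.
      by rewrite inE hM orbT.
    - apply/eqP => PE; move: lPP; rewrite PE; apply/negP/PM.
      by rewrite inE lM orbT.
    - rewrite -nth0 -nth_last nth_uniq ?(ltnW M1) //.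
        by case: (size M) M1 => [|[]].
      by case: (size M) M1 => [|[]].
  by rewrite mulrN.
Qed.

(** * The generating sum of windings *)

(** Reindexing by [f] shows that the sum equals its opposite; in an arbitrary abelian group this
    kills only its double. *)
Lemma big_anti_involution (T : eqType) (V : zmodType) (s : seq T) (f : T -> T)
    (F : T -> V) : uniq s -> {in s, forall x, f x \in s} ->
  {in s, forall x, f (f x) = x} -> {in s, forall x, F (f x) = - F x} ->
  (\sum_(x <- s) F x) *+ 2 = 0.
Proof.
move=> us fs ff Ff; have pfs : perm_eq [seq f x | x <- s] s.
  apply: uniq_perm => //.
    by rewrite map_inj_in_uniq // => x y xs ys fxy; rewrite -(ff x) // fxy ff.
  move=> x; apply/mapP/idP => [[y ys ->]|xs]; first exact: fs.
  by exists (f x); rewrite ?fs ?ff.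
rewrite mulr2n -{1}(perm_big _ pfs) big_map big_seq.
rewrite (eq_bigr (fun x => - F x)) //.
by rewrite -big_seq sumrN addNr.
Qed.

Section SlitSum.
Variables (F : fieldType) (z : F).
Hypotheses (z8 : z ^+ 8 = -1) (two_neq0 : 2 != 0 :> F).

Let z_neq0 : z != 0.
Proof.
by apply: contra_eq_neq z8 => ->; rewrite expr0n /= eq_sym oppr_eq0 oner_neq0.
Qed.

Lemma spoilt_sum n : \sum_(b <- spoilt n) z ^ winding b = 0.
Proof.
have flipP b : b \in spoilt n -> [/\ flip b \in spoilt n, flip (flip b) = b &
    exists r e : int, [/\ (e = 1 \/ e = -1), winding b = r + 4 * e &
                     winding (flip b) = r - 4 * e]].
  case/mem_spoilt=> w [u [-> [sw szw] au bu uE]].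
  case: (boolP (slit_plane u)) uE => su; last by move=> _; apply: flip_exit.
  by rewrite orbF => uw; apply: flip_loop.
have : (\sum_(b <- spoilt n) z ^ winding b) *+ 2 = 0.
  apply: (@big_anti_involution _ _ _ flip).
  - exact/filter_uniq/extensions_uniq.
  - by move=> b /flipP[].
  - by move=> b /flipP[].
  move=> b /flipP[_ _ [r [e [eE -> ->]]]].
  rewrite !expfzDr // -[RHS]mulrN; congr (_ * _).
  have z4 : z ^ 4 * z ^ 4 = -1 by rewrite -expfzDr // -z8.
  have z4_0 : z ^ 4 != 0 by rewrite expfz_neq0.
  case: eE => ->; rewrite ?mulr1 ?mulrN1 ?opprK.
  - by apply: (mulfI z4_0); rewrite -expfzDr // addrN expr0z mulrN z4 opprK.
  - by apply: (mulfI z4_0); rewrite z4 mulrN -expfzDr // addrN expr0z.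
by rewrite -mulr_natr => /eqP; rewrite mulf_eq0 (negbTE two_neq0) orbF => /eqP.
Qed.

Lemma extensions_sum w : slit_saw w ->
  \sum_(b <- extensions w) z ^ winding b = z ^ winding w * (z + z^-1).
Proof.
move=> sw; have sz : (1 < size w)%N by move: sw; rewrite slit_sawE => /and5P[].
rewrite /extensions big_map big_filter.
under eq_bigr => u _ do rewrite winding_rcons // expfzDr //.
rewrite -big_distrr /=; congr (_ * _).
set x := nth _ _ _; set v := last _ _.
have xv : x \in rotation v.
  rewrite mem_rotation adj_sym /x /v -nth_last.
  have -> : (size w).-1 = (size w).-2.+1 by case: (w) sz => [|? []].
  move: sw; rewrite slit_sawE => /and5P[_ /(sortedP (0, 0)) adjw _ _ _].
  by apply: adjw; case: (w) sz => [|? []].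
(* In a cyclic order of three, removing [d] leaves its predecessor, the left turn, and its
   successor, the right turn. *)
have turn_sum (T : eqType) (a b c d : T) :
    uniq [:: a; b; c] -> d \in [:: a; b; c] ->
    \sum_(e <- [:: a; b; c] | e != d)
      z ^ (if e == prev [:: a; b; c] d then 1 else -1 : int) = z + z^-1.
  move=> /[dup] un /prev3[da db dc].
  have /and3P[ab ac bc] : [&& a != b, a != c & b != c].
    by move: un; rewrite /= !inE negb_or andbT -andbA.
  have [ba ca cb] : [/\ (b == a) = false, (c == a) = false & (c == b) = false].
    by split; apply/negbTE; rewrite eq_sym.
  have -> : z + z^-1 = z ^ (1 : int) + z ^ (-1 : int) by rewrite expr1z exprN1.
  rewrite !inE => /or3P[] /eqP->; rewrite ?(da, db, dc) !big_cons big_nil !eqxx.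
  - by rewrite ba ca (negbTE bc) /= addr0 addrC.
  - by rewrite (negbTE ab) cb ca /= addr0.
  - by rewrite (negbTE ac) (negbTE bc) (negbTE ab) /= addr0 addrC.
move: x xv; rewrite /hook_weight; case: v => a b x.
have := rotation_uniq (a, b).
case: (boolP (even_vertex (a, b))) => [/rotation_even|/rotation_odd] ->;
  exact: turn_sum.
Qed.

Lemma slit_saws_sum n :
  \sum_(w <- slit_saws n) z ^ winding w = (z + z^-1) ^+ n.
Proof.
elim: n => [|n IHn].
  by rewrite big_seq1 /winding /= big_ord0 expr0z.
rewrite exprSr -IHn big_distrl /= big_filter.
(* The spoilt prolongations are put back, their sum being zero. *)
transitivity (\sum_(b <- flatten [seq extensions w | w <- slit_saws n])
                z ^ winding b).
  rewrite [RHS](bigID slit_saw) /= -[X in _ = _ + X]big_filter.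
  by rewrite -[[seq b <- _ | _]]/(spoilt n) spoilt_sum addr0.
rewrite big_flatten /= big_map big_seq [RHS]big_seq.
apply: eq_bigr => w; rewrite mem_slit_saws => /andP[sw _].
exact: extensions_sum.
Qed.
End SlitSum.

(** * Geometric series, roots of unity and final directions *)

Lemma fps_div_geometric (K : fieldType) (c : K) n :
  fps_div (fps_of_poly 'X) (fps_of_poly (1 + c%:P * 'X)) n =
  if n is m.+1 then (- c) ^+ m else 0.
Proof.
have coefE k : fps_of_poly (1 + c%:P * 'X) k =
    (k == 0%N)%:R + c * (k == 1%N)%:R.
  by rewrite /fps_of_poly coefD coefCM coefX coef1.
have invE k : fps_inv (fps_of_poly (1 + c%:P * 'X)) k = (- c) ^+ k.
  elim: k => [|k IHk].
    by rewrite /fps_inv /= coefE /= mulr0 addr0 invr1 expr0.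
  rewrite fps_invS coefE /= mulr0 addr0 invr1 big_ord_recr /= subSnn coefE /=.
  rewrite big1 => [|i _]; last first.
    rewrite coefE subSn ?[(i <= k)%N]ltnW // eqSS subn_eq0 leqNgt ltn_ord.
    by rewrite mulr0 addr0 mul0r.
  by rewrite IHk !add0r mulr1 mulN1r exprS mulNr.
rewrite /fps_div /fps_mul; case: n => [|n].
  by rewrite big_ord1 /fps_of_poly coefX mul0r.
rewrite big_ord_recl big_ord_recl /= big1 => [|i _].
  rewrite /fps_of_poly !coefX mul0r mul1r add0r addr0 -/fps_of_poly.
  by rewrite invE subSS subn0.
by rewrite /fps_of_poly coefX mul0r.
Qed.

Section Expi.
Variable R : realType.
Implicit Types s t : R.

Lemma expiD s t : expi (s + t) = expi s * expi t.
Proof. by rewrite /expi cosD sinD; congr (_ +i* _); rewrite addrC. Qed.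

Lemma expi0 : expi (0 : R) = 1.
Proof. by rewrite /expi cos0 sin0. Qed.

Lemma expiX t n : expi t ^+ n = expi (t * n%:R).
Proof.
elim: n => [|n IHn]; first by rewrite mulr0 expi0 expr0.
by rewrite exprS IHn -expiD -[in RHS]addn1 natrD mulrDr mulr1 addrC.
Qed.

Lemma expi_neq0 t : expi t != 0.
Proof.
have : expi t * expi (- t) != 0 by rewrite -expiD subrr expi0 oner_neq0.
by rewrite mulf_eq0 negb_or => /andP[].
Qed.

Lemma expiV t : (expi t)^-1 = expi (- t).
Proof.
apply: (mulfI (expi_neq0 t)).
by rewrite divff ?expi_neq0 // -expiD subrr expi0.
Qed.

Lemma expi_pi : expi (pi : R) = -1.
Proof.
by rewrite /expi cospi sinpi; apply/eqP; rewrite eq_complex /= oppr0 !eqxx.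
Qed.

Lemma Re_expi t : 2 * 'Re (expi t) = expi t + (expi t)^-1.
Proof.
rewrite expiV -complexRe /expi cosN sinN; apply/eqP.
rewrite eq_complex /= subrr !addr0 !(mul0r, mulr0) subr0 addr0.
by rewrite mulrDl mul1r !eqxx.
Qed.

Lemma expi_2pi n : expi (2 * pi * n%:R : R) = 1.
Proof. by rewrite -expiX [2 * _]mulrC -expiX expi_pi sqrrN expr1n expr1n. Qed.

Lemma zeta3 : zeta R ^+ 3 = -1.
Proof. by rewrite /zeta expiX (_ : _ * _ = pi) ?expi_pi //; field. Qed.

Lemma zeta_neqN1 : zeta R != -1.
Proof.
apply/eqP => /(congr1 (@complex.Im R)) /=; rewrite oppr0 => sin0.
have : 0 < sin (2 * pi / 6 : R).
  apply: sin_gt0_pi; have := pi_gt0 R; lra.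
by rewrite sin0 ltxx.
Qed.

Lemma y48 j : y_ R j ^+ 48 = 1.
Proof.
by rewrite /y_ expiX -(expi_2pi (6 * j + 1)); congr expi; field.
Qed.

(** The angle of [zeta * y_ j] is [2 * pi * (6 * j + 9) / 48], and eight times that is
    [2 * pi * (j + 1) + pi]. *)
Lemma zeta_y8 j : (zeta R * y_ R j) ^+ 8 = -1.
Proof.
transitivity (expi (2 * pi * j.+1%:R + pi : R)); last first.
  by rewrite expiD expi_2pi expi_pi mul1r.
by rewrite -expiD expiX; congr expi; rewrite natrD natrM -natr1; field.
Qed.

(** The sign appears because [ell] looks back from [v], against the direction of travel. *)
Lemma heading_ell u v : adj u v -> ell R v u = - zeta R ^ heading u v.
Proof.
have z0 : zeta R != 0 by exact: expi_neq0.
have zV : zeta R ^ (- 1 : int) = - zeta R ^+ 2.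
  rewrite exprN1; apply: (mulfI z0); rewrite divff // mulrN -exprS zeta3.
  by rewrite opprK.
have zV2 : zeta R ^ (- 2 : int) = - zeta R.
  by rewrite -[LHS]exprVn -exprN1 zV sqrrN -exprM (exprD _ 3 1) zeta3 mulN1r.
have z3 : zeta R ^ (3 : int) = -1 by exact: zeta3.
move=> uv; rewrite /ell /ell_b /basic !vertex_eqE !adjE /heading.
case: u uv => a b; case: (boolP (even_vertex (a, b))) => ev.
  move/(adj_even _ _ _ ev) => vE; move: vE ev; rewrite /even_vertex /=.
  case=> -> /= ev; (do !case: ifPn => /= ?); try (by exfalso; lia);
    by rewrite ?expr0z ?zV2 ?opprK.
move/(adj_odd _ _ _ ev) => vE; move: vE ev; rewrite /even_vertex /=.
case=> -> /= ev; (do !case: ifPn => /= ?); try (by exfalso; lia);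
  by rewrite ?expr1z ?z3 ?zV ?opprK.
Qed.

(** The first edge has heading 0, so by [sum_hook_weight] the winding is the last heading modulo 6,
    the order of [zeta]. *)
Lemma walk_ellE w : slit_saw w -> walk_ell R w = - zeta R ^ winding w.
Proof.
rewrite slit_sawE => /and5P[sw adjw uw tw _].
have z6 (m : int) : (zeta R) ^ (6 * m) = 1.
  rewrite -exprz_exp (_ : zeta R ^ 6 = 1) ?exp1rz //.
  by rewrite -[LHS]/(zeta R ^+ (3 * 2)) exprM zeta3 sqrrN expr1n.
pose v : nat -> vertex := nth (0, 0) w.
have [x [y [w' wE]]] : exists x y w', w = [:: x, y & w'].
  by case: (w) sw => [|x [|y w']] //= _; exists x, y, w'.
have -> : winding w = \sum_(i < size w') hook_weight (v i) (v i.+1) (v i.+2).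
  by rewrite /winding wE /= !subSS subn0 /v wE.
rewrite sum_hook_weight; last first.
- move=> i im; have i2 : (i.+2 < size w)%N by rewrite wE.
  have i0 : (i < size w)%N := ltnW (ltnW i2).
  by rewrite /v nth_uniq // neq_ltn leqnSn.
- by move=> i im; apply: (sortedP (0, 0) adjw); rewrite wE.
have -> : heading (v 0%N) (v 1%N) = 0.
  by move: tw; rewrite /v wE /= take0 => /eqP[-> ->].
rewrite subr0 expfzDr ?expi_neq0 // z6 mulr1 -heading_ell.
  by rewrite /walk_ell /v wE.
by apply: (sortedP (0, 0) adjw); rewrite wE.
Qed.

End Expi.

(** * From the coefficients of the series to sums over walks *)

Lemma sum_select (K : pzSemiRingType) m (F : nat -> K) (P : pred nat) i0 :
  (i0 < m)%N -> (forall i, (i < m)%N -> P i = (i == i0)) ->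
  \sum_(i < m) F i * (P i)%:R = F i0.
Proof.
move=> i0m PE; rewrite (bigD1 (Ordinal i0m)) //= PE // eqxx mulr1.
rewrite big1 ?addr0 // => i; rewrite -val_eqE PE //= => /negbTE->.
by rewrite mulr0.
Qed.

Section Coefficients.
Variable R : realType.

Lemma G_coef0 l k : G_coef R l k 0 = 0%N.
Proof.
rewrite /G_coef (_ : G_walks R l k 0 = set0) ?fset_set0 ?cardfs0 //.
apply/seteqP; split=> [w [sw wl _ _]|//].
move: sw wl; rewrite slit_sawE /walk_length.
by case: w => [|x [|y w]].
Qed.

Lemma G_coefS l k n : G_coef R l k n.+1 = (\sum_(w <- slit_saws n)
  ((walk_ell R w == zeta R ^+ l) && ((winding w == k%:Z %[mod 48])%Z)))%N.
Proof.
pose P w := (walk_ell R w == zeta R ^+ l) && (winding w == k%:Z %[mod 48])%Z.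
have -> : G_coef R l k n.+1 = size [seq w <- slit_saws n | P w].
  rewrite /G_coef (_ : fset_set _ = seq_fset tt [seq w <- slit_saws n | P w]).
    rewrite size_seq_fset undup_id //; apply: filter_uniq.
    by case: n => [//|n]; apply/filter_uniq/extensions_uniq.
  apply/fsetP => w; rewrite in_fset_set; last exact: finite_G_walks.
  rewrite seq_fsetE mem_filter mem_slit_saws /P; apply/idP/idP.
    move/set_mem => [sw wl /eqP-> /eqP->]; rewrite sw.
    move: wl sw; rewrite /walk_length slit_sawE => wl /andP[sz _].
    by case: (w) wl sz => //= ? ? ->.
  case/andP=> /andP[/eqP we /eqP wk] /andP[sw /eqP sz].
  by apply/mem_set; split=> //; rewrite /walk_length sz.
by rewrite size_filter -sum1_count big_mkcond.
Qed.

Lemma exprz_mod (K : fieldType) (y : K) (d : nat) (m : int) : (0 < d)%N ->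
  y != 0 -> y ^+ d = 1 -> y ^ m = y ^+ `|(m %% d)%Z|%N.
Proof.
move=> d0 y0 yd; rewrite {1}(divz_eq m d) expfzDr // mulrC.
rewrite [(_ * _)%R in X in _ * X]mulrC -exprz_exp -[y ^ d%:Z]/(y ^+ d) yd.
rewrite exp1rz mulr1.
by rewrite -[in LHS](@gez0_abs (m %% d)%Z) // modz_ge0 // eqz_nat -lt0n.
Qed.

Lemma absz_modz_lt (m : int) (d : nat) : (0 < d)%N -> (`|(m %% d)%Z| < d)%N.
Proof.
move=> d0; rewrite -ltz_nat gez0_abs ?ltz_pmod //.
by rewrite modz_ge0 // eqz_nat -lt0n.
Qed.

Lemma zetaX_neq1 d : (0 < d < 6)%N -> zeta R ^+ d != 1.
Proof.
have n1 : (1 == -1 :> R[i]) = false by rewrite -addr_eq0 (pnatr_eq0 _ 2).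
have zN1 := zeta_neqN1 R; have z3 := zeta3 R.
have z1 : zeta R != 1.
  by apply/eqP => z1; move/eqP: z3; rewrite z1 expr1n n1.
case: d => [|[|[|[|[|[|d]]]]]] // _; apply/eqP => zd.
- by case/eqP: zN1; rewrite -z3 exprS zd mulr1.
- by move/eqP: zd; rewrite z3 eq_sym n1.
- by case/eqP: zN1; rewrite -zd exprS z3 mulrN1 opprK.
- case/eqP: z1; rewrite -[LHS]mulr1 -zd -exprS (exprD _ 3 3) z3.
  by rewrite mulrNN mulr1.
Qed.

Lemma zetaX_inj i j : (i < 6)%N -> (j < 6)%N ->
  (zeta R ^+ i == zeta R ^+ j) = (i == j).
Proof.
wlog ij : i j / (i <= j)%N.
  move=> H i6 j6; case: (leqP i j) => [|/ltnW] ij; first exact: H.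
  by rewrite eq_sym H // eq_sym.
move=> i6 j6; move: ij; rewrite leq_eqVlt => /orP[/eqP->|ij].
  by rewrite !eqxx.
have zi0 : zeta R ^+ i != 0 by rewrite expf_neq0 // expi_neq0.
rewrite (ltn_eqF ij) -(subnKC (ltnW ij)) exprD -[X in X == _]mulr1.
rewrite (inj_eq (mulfI zi0)) eq_sym; apply/negbTE/zetaX_neq1.
by rewrite subn_gt0 ij (leq_ltn_trans (leq_subr _ _) j6).
Qed.

Lemma sum_zeta (m : int) :
  \sum_(l < 6) zeta R ^+ l * (- zeta R ^ m == zeta R ^+ l)%:R = - zeta R ^ m.
Proof.
have z0 : zeta R != 0 by exact: expi_neq0.
(* The sign is itself a power of [zeta], so exactly one [l] is selected. *)
have -> : - zeta R ^ m = zeta R ^ (m + 3).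
  by rewrite expfzDr // -[zeta R ^ 3]/(zeta R ^+ 3) zeta3 mulrN1.
have z6 : zeta R ^+ 6 = 1 by rewrite (exprD _ 3 3) zeta3 mulrNN mulr1.
rewrite (@exprz_mod _ _ 6) //; set a := `|_|%N.
have a6 : (a < 6)%N by exact: absz_modz_lt.
apply: (@sum_select _ 6 _ (fun l => zeta R ^+ a == zeta R ^+ l) a) => // i i6.
by rewrite zetaX_inj // eq_sym.
Qed.

Lemma sum_mod48 (y : R[i]) (m : int) : y ^+ 48 = 1 -> y != 0 ->
  \sum_(k < 48) y ^+ k * ((m == k%:Z %[mod 48])%Z)%:R = y ^ m.
Proof.
move=> y48 y0; rewrite (@exprz_mod _ _ 48) //.
apply: (@sum_select _ 48 _ (fun k => m == k%:Z %[mod 48])%Z).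
  exact: absz_modz_lt.
move=> k k48; rewrite (@modz_small k) // -eqz_nat gez0_abs ?modz_ge0 //.
Qed.

(** Each walk is counted for exactly one pair [(l, k)], and the power of [y_ j] depends on the
    winding only modulo 48. *)
Lemma G_sum j n : \sum_(l < 6) \sum_(k < 48)
    zeta R ^+ l * y_ R j ^+ k * (G_coef R l k n.+1)%:R =
  \sum_(w <- slit_saws n) walk_ell R w * y_ R j ^ winding w.
Proof.
have y0 : y_ R j != 0 by exact: expi_neq0.
transitivity (\sum_(w <- slit_saws n)
    (\sum_(l < 6) zeta R ^+ l * (walk_ell R w == zeta R ^+ l)%:R) *
    (\sum_(k < 48) y_ R j ^+ k * ((winding w == k%:Z %[mod 48])%Z)%:R)).
  under [RHS]eq_bigr => w _.
    rewrite big_distrlr /=.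
    under eq_bigr => l _.
      under eq_bigr => k _ do rewrite mulrACA -natrM mulnb.
      over.
    over.
  rewrite [RHS]exchange_big; apply: eq_bigr => l _.
  rewrite [RHS]exchange_big; apply: eq_bigr => k _.
  by rewrite G_coefS natr_sum -big_distrr.
apply: eq_big_seq => w; rewrite mem_slit_saws => /andP[sw _].
by rewrite sum_mod48 ?y48 // walk_ellE // sum_zeta.
Qed.

End Coefficients.

(** * The formal identity and the divergence at [x_c] *)

Section Main.
Variable R : realType.

Lemma zeta4_y j : - (2 * 'Re (zeta R ^+ 4 * y_ R j)) =
  zeta R * y_ R j + (zeta R * y_ R j)^-1.
Proof.
have -> : zeta R ^+ 4 * y_ R j = - (zeta R * y_ R j).
  by rewrite exprSr zeta3 mulN1r mulNr.
rewrite raddfN mulrN opprK /zeta /y_ -expiD; exact: Re_expi.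
Qed.

(** With [z = zeta * y_ j], a walk of winding [r] contributes [- z ^ r] to the double sum, so both
    coefficients of index [n.+1] equal [(z + 1 / z) ^ n]. *)
Lemma series_identity j :
  fps_div (fps_of_poly 'X)
          (fps_of_poly (1 + (2 * 'Re (zeta R ^+ 4 * y_ R j))%:P * 'X))
  =1 fun n => - \sum_(l < 6) \sum_(k < 48)
                  zeta R ^+ l * y_ R j ^+ k * (G_coef R l k n)%:R.
Proof.
move=> [|n]; rewrite fps_div_geometric.
  rewrite big1 ?oppr0 // => l _; rewrite big1 // => k _.
  by rewrite G_coef0 mulr0.
rewrite G_sum zeta4_y -slit_saws_sum ?zeta_y8 ?pnatr_eq0 // -sumrN.
apply: eq_big_seq => w; rewrite mem_slit_saws => /andP[sw _].
by rewrite walk_ellE // mulNr opprK expfzMl.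
Qed.

Lemma norm_expi (t : R) : `|expi t| = 1.
Proof. by rewrite normc_def /= cos2Dsin2 sqrtr1. Qed.

Lemma cos_pi8_gt0 : 0 < cos (pi / 8 : R).
Proof. by apply: cos_gt0_pihalf; have := pi_gt0 R; lra. Qed.

Lemma x_c_gt0 : 0 < x_c R.
Proof. by rewrite invr_gt0 mulr_gt0 // cos_pi8_gt0. Qed.

Lemma zeta_y7 : zeta R * y_ R 7 = expi (pi / 8).
Proof.
transitivity (expi (2 * pi * 1%:R + pi / 8 : R)).
  by rewrite -expiD; congr expi; field.
by rewrite expiD expi_2pi mul1r.
Qed.

(** The triangle inequality in the identity for [j = 7], all factors [zeta ^ l * y ^ k] having
    modulus 1. *)
Lemma G_coef_lower n : x_c R ^- n <=
  \sum_(l < 6) \sum_(k < 48) (G_coef R l k n.+1)%:R.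
Proof.
have := series_identity 7 n.+1; rewrite fps_div_geometric zeta4_y zeta_y7.
rewrite -Re_expi -complexRe => H.
rewrite -lecR.
have -> : (x_c R ^- n)%:C = `|(2 * (complex.Re (expi (pi / 8 : R)))%:C) ^+ n|.
  rewrite /x_c exprVn invrK normrX rmorphXn rmorphM rmorph_nat /=.
  congr (_ ^+ _).
  by rewrite ger0_norm // mulr_ge0 // lecR ltW // cos_pi8_gt0.
rewrite H normrN (le_trans (ler_norm_sum _ _ _)) //.
rewrite rmorph_sum; apply: ler_sum => l _.
rewrite (le_trans (ler_norm_sum _ _ _)) // rmorph_sum; apply: ler_sum => k _.
by rewrite /zeta /y_ !expiX -expiD normrM norm_expi mul1r normr_nat rmorph_nat.
Qed.

Lemma G_diverges : exists l k : nat, [/\ (l < 6)%N, (k < 48)%N &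
  (\sum_(0 <= n <oo) ((G_coef R l k n)%:R * x_c R ^+ n)%R%:E = +oo)%E].
Proof.
apply: contrapT => nodiv.
pose S l k := (\sum_(0 <= n <oo) ((G_coef R l k n)%:R * x_c R ^+ n)%R%:E)%E.
have x0 := x_c_gt0.
have term_ge0 l k n : 0 <= (G_coef R l k n)%:R * x_c R ^+ n.
  by rewrite mulr_ge0 // exprn_ge0 // ltW.
have S_ge0 l k : (0 <= S l k)%E.
  by apply: nneseries_ge0 => n _ _; rewrite lee_fin.
have S_fin l k : (l < 6)%N -> (k < 48)%N -> S l k \is a fin_num.
  move=> l6 k48; rewrite ge0_fin_numE // ltey; apply/eqP => Soo.
  by apply: nodiv; exists l, k.
have partial l k N : (l < 6)%N -> (k < 48)%N ->
    \sum_(0 <= n < N) (G_coef R l k n)%:R * x_c R ^+ n <= fine (S l k).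
  move=> l6 k48; rewrite -lee_fin fineK ?S_fin // -sumEFin.
  by apply: nneseries_lim_ge => n _ _; rewrite lee_fin.
pose B := \sum_(l < 6) \sum_(k < 48) fine (S l k).
(* By [G_coef_lower] the terms of index [n.+1] add up, over all [(l, k)], to at least
   [x_c ^- n * x_c ^ n.+1 = x_c]; the terms of index 0 are dropped. *)
have bound N : x_c R *+ N <= B.
  apply: (@le_trans _ _ (\sum_(l < 6) \sum_(k < 48)
      \sum_(n < N.+1) (G_coef R l k n)%:R * x_c R ^+ n)); last first.
    apply: ler_sum => l _; apply: ler_sum => k _.
    rewrite -(big_mkord xpredT (fun n => (G_coef R l k n)%:R * x_c R ^+ n)).
    exact: partial.
  under eq_bigr do rewrite exchange_big.
  rewrite exchange_big big_ord_recl -[leLHS]add0r lerD //.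
    by apply: sumr_ge0 => l _; apply: sumr_ge0.
  rewrite -[X in _ *+ X]card_ord -sumr_const; apply: ler_sum => n _.
  under eq_bigr do rewrite -mulr_suml.
  rewrite -mulr_suml (le_trans _ (ler_wpM2r _ (G_coef_lower n))) //.
    by rewrite exprSr mulrA mulVf ?mul1r // expf_neq0 // gt_eqF.
  by rewrite exprn_ge0 // ltW.
have := bound (Num.truncn (B / x_c R)).+1.
apply/negP; rewrite -ltNge -mulr_natl -ltr_pdivrMr //; exact: truncnS_gt.
Qed.
End Main.

Theorem corollary6 (R : realType) :
  (forall j : nat, (j < 8)%N ->
     fps_div (fps_of_poly 'X)
             (fps_of_poly (1 + (2 * 'Re (zeta R ^+ 4 * y_ R j))%:P * 'X))
     =1 fun n => - \sum_(l < 6) \sum_(k < 48)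
                     zeta R ^+ l * y_ R j ^+ k * (G_coef R l k n)%:R)
  /\ (exists l k : nat, [/\ (l < 6)%N, (k < 48)%N &
        (\sum_(0 <= n <oo) ((G_coef R l k n)%:R * x_c R ^+ n)%R%:E = +oo)%E]).
Proof.
by split=> [j _|]; [exact: series_identity|exact: G_diverges].
Qed.
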